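(* Let $\mathcal{G}'$ be a finite simple undirected $3$-regular graph. Then $\mathcal{G}'$ admits a swift phases configuration if and only if one of the following equivalent conditions is met: (1) $\mathcal{G}'$ has a perfect matching; (2) $\mathcal{G}'$ can be covered with vertex disjoint cycles (it has a $2$-factor). (That is: conditions (1) and (2) are equivalent to each other, and each is equivalent to the existence of a swift phases configuration for $\mathcal{G}'$.)
   Context: Let $\mathcal{G}'$ be a finite simple undirected graph with $N$ vertices and adjacency matrix $\mathbf{A}$. A chiral adjacency matrix on $\mathcal{G}'$ is an $N\times N$ hermitian matrix $\tilde{\mathbf{A}}$ such that $\tilde{\mathbf{A}}_{jk}$ is a complex number of modulus $1$ whenever $\mathbf{A}_{jk}=1$, and $\tilde{\mathbf{A}}_{jk}=0$ whenever $\mathbf{A}_{jk}=0$ (in particular the diagonal is zero). $\mathcal{G}'$ admits a swift phases configuration if there exists a chiral adjacency matrix $\tilde{\mathbf{A}}$ on $\mathcal{G}'$ such that $\tilde{\mathbf{A}}\,\mathbf{1}_N=0$, where $\mathbf{1}_N$ is the all-ones vector, i.e. such that each row of $\tilde{\mathbf{A}}$ sums to zero. A perfect matching is a partition of the vertex set into pairs of adjacent vertices. $\mathcal{G}'$ can be covered with vertex disjoint cycles if there is a set of cycles that are subgraphs of $\mathcal{G}'$ such that each vertex of $\mathcal{G}'$ belongs to exactly one of these cycles. *)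

(* Defs.v *)
From HB Require Import structures.
From mathcomp Require Export all_boot all_order all_algebra.
From mathcomp Require Export sesquilinear spectral reals complex.

Set Implicit Arguments.
Unset Strict Implicit.
Unset Printing Implicit Defensive.

Import Order.TTheory GRing.Theory Num.Theory.
Local Open Scope ring_scope.

Record sgraph (N : nat) := SGraph {
  adj : rel 'I_N;
  adj_sym : symmetric adj;
  adj_irr : irreflexive adj
}.

Definition regular (d N : nat) (G : sgraph N) : Prop :=
  forall v : 'I_N, #|[set w | adj G v w]| = d.

Definition adjmx (K : nzRingType) (N : nat) (G : sgraph N) : 'M[K]_N :=
  \matrix_(j < N, k < N) (adj G j k)%:R.

Definition chiral_adjmx (R : realType) (N : nat) (G : sgraph N)
    (At : 'M[R[i]]_N) : Prop :=
  [/\ At \is hermsymmx,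
      forall j k : 'I_N, adjmx R[i] G j k = 1 -> `|At j k| = 1
    & forall j k : 'I_N, adjmx R[i] G j k = 0 -> At j k = 0].

Definition swift_phases (R : realType) (N : nat) (G : sgraph N) : Prop :=
  exists At : 'M[R[i]]_N,
    chiral_adjmx G At /\ At *m (const_mx 1 : 'cV[R[i]]_N) = 0.

Definition perfect_matching (N : nat) (G : sgraph N) : Prop :=
  exists P : {set {set 'I_N}},
    partition P [set: 'I_N] /\
    forall B, B \in P -> exists x y, adj G x y /\ B = [set x; y].

(* A subgraph is encoded as the pair of its vertex set and its edge set. The
   bound on the size rules out [:: x; y], which is a [ucycle] as soon as x and
   y are adjacent. *)
Definition cycle_subgraph (N : nat) (G : sgraph N)
    (H : {set 'I_N} * {set {set 'I_N}}) : Prop :=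
  exists c : seq 'I_N,
    [/\ ucycle (adj G) c, (3 <= size c)%N,
        H.1 = [set x in c]
      & H.2 = [set [set x; next c x] | x in c]].

Definition disjoint_cycle_cover (N : nat) (G : sgraph N) : Prop :=
  exists C : {set {set 'I_N} * {set {set 'I_N}}},
    (forall H, H \in C -> cycle_subgraph G H) /\
    forall v : 'I_N, exists! H, H \in C /\ v \in H.1.

(* Main.v *)
(* Three unit complex numbers with zero sum are z, z w, z w^2 with w a primitive
   cube root of unity. Exactly one of them has real part > 1/2 or equals -1, a
   condition invariant under conjugation; hence in a swift phases configuration
   the edges whose phase satisfies it form a perfect matching, and no case
   distinction on bipartiteness nor Hall's theorem is needed. Conversely, the
   complement of a perfect matching is 2-regular and can be oriented so that its
   components become directed cycles; the phases 1 on the matching, w along the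
   orientation and w^2 against it sum to zero at each vertex. These directed
   cycles also cover the vertices. *)
Require Import Defs.
From mathcomp Require Import ring lra.

Set Implicit Arguments.
Unset Strict Implicit.
Unset Printing Implicit Defensive.

Import Order.TTheory GRing.Theory Num.Theory.

(** * Orientation of 2-regular graphs *)

(* The orbits of [b \o a] are permuted by [a] and [b] without fixed orbit, so
   comparing the orbit of [x] with that of [a x] in any total order works. *)
Lemma involutions_bipartition (T : finType) (a b : T -> T) :
    involutive a -> involutive b -> (forall x, a x != x) ->
    (forall x, b x != x) ->
  exists D : pred T, forall x, D (a x) = ~~ D x /\ D (b x) = ~~ D x.
Proof.
move=> aK bK aN bN; pose f x := b (a x).
have f_inj : injective f by apply: inj_comp; apply: can_inj; eassumption.
have fsym := fconnect_sym f_inj.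
(* Since [f (a (f x)) = a x], an equality for [n + 2] and [x] descends to one for [n] and [f x],
   ending at a fixed point of [a] or [b]. *)
have iter_f_neq n x : iter n f x <> a x.
  have [k] := ubnP n; elim: k n x => // k IHk [|[|n]] x.
  - by move=> _ /esym/eqP; apply/negP.
  - by move=> _ /eqP; apply/negP/bN.
  move=> ltnk E; apply: (IHk n (f x)); first exact: ltnW.
  by apply: f_inj; rewrite -iterS -iterSr E /f aK bK.
have root_a x : froot f x != froot f (a x).
  rewrite (root_connect fsym); apply/negP => xax.
  exact: (@iter_f_neq (findex f x (a x)) x) (iter_findex xax).
have root_b x : froot f (b x) = froot f (a x).
  apply/eqP; rewrite (root_connect fsym) fsym.
  by have := fconnect1 f (a x); rewrite /f aK.
have root_ab x : froot f (a (b x)) = froot f x.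
  apply/eqP; rewrite (root_connect fsym).
  by have := fconnect1 f (a (b x)); rewrite /f aK bK.
exists (fun x => enum_rank (froot f x) < enum_rank (froot f (a x))) => x.
rewrite root_ab root_b aK -leqNgt ltn_neqAle andb_idl // => _.
by apply: contra (root_a x) => /eqP/ord_inj/enum_rank_inj->.
Qed.

(** The map [s] follows the outgoing edge: injectivity leaves one incoming edge per vertex, and
    [s (s x) != x] forbids orienting an edge both ways. *)
Lemma two_regular_orientation (T : finType) (F : rel T) :
    symmetric F -> irreflexive F -> (forall x, #|[set y | F x y]| = 2) ->
  exists s : T -> T,
    [/\ injective s, forall x, s (s x) != x
      & forall x y, F x y = (y == s x) || (x == s y)].
Proof.
move=> Fsym Firr F2.
(* For adjacent [x] and [y], [o x y] is the neighbour of [x] other than [y]. *)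
have [o oP] : exists o : T -> T -> T, forall x y, F x y ->
    [/\ F x (o x y), o x y != y & forall z, F x z -> z = y \/ z = o x y].
  suff /fin_all_exists[o oP] : forall x, exists g : T -> T, forall y, F x y ->
    [/\ F x (g y), g y != y & forall z, F x z -> z = y \/ z = g y].
    by exists o => x; apply: oP.
  move=> x; have /eqP/cards2P[u [v [uv Exuv]]] := F2 x.
  have EF z : F x z = (z == u) || (z == v).
    by have := in_set2 z u v; rewrite -Exuv inE.
  exists (fun y => if y == u then v else u) => y; rewrite !EF.
  case: eqVneq => [-> _|_ /= /eqP->]; rewrite ?eqxx ?orbT ?(eq_sym v) ?uv //.
    by split=> // z; rewrite EF => /orP[]/eqP; tauto.
  by split=> // z; rewrite EF => /orP[]/eqP; tauto.
have oK x y : F x y -> o x (o x y) = y.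
  move=> Fxy; have [Fo oy _] := oP x y Fxy.
  have [Foo ooy] := oP _ _ Fo; have [_ _ /(_ _ Foo)[]//] := oP x y Fxy.
  by move=> E; rewrite E eqxx in ooy.
(* Reversing a dart and turning it to the other edge at its source are two
   fixed-point-free involutions; an orientation is a class of their
   bipartition. *)
pose dart := {p : T * T | F p.1 p.2}.
have aP (p : dart) : F (val p).2 (val p).1 by rewrite Fsym; apply: valP p.
have bP (p : dart) : F (val p).1 (o (val p).1 (val p).2).
  by have [] := oP _ _ (valP p).
pose a (p : dart) : dart := exist _ ((val p).2, (val p).1) (aP p).
pose b (p : dart) : dart := exist _ ((val p).1, o (val p).1 (val p).2) (bP p).
have aK : involutive a by move=> [[x y] Fxy]; apply: val_inj.
have bK : involutive b.
  by move=> [[x y] Fxy]; apply: val_inj; rewrite /= oK.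
have aN p : a p != p.
  case: p => -[x y] /= Fxy; rewrite -val_eqE /= xpair_eqE.
  by apply/negP => /andP[_ /eqP E]; move: Fxy; rewrite /= E Firr.
have bN p : b p != p.
  case: p => -[x y] /= Fxy; rewrite -val_eqE /= xpair_eqE eqxx /=.
  by have [] := oP _ _ Fxy.
have [D0 D0P] := involutions_bipartition aK bK aN bN.
pose D x y := if insub (x, y) is Some p then D0 p else false.
have DE x y (Fxy : F x y) : D x y = D0 (exist _ (x, y) Fxy).
  by rewrite /D insubT.
have Drev x y : F x y -> D y x = ~~ D x y.
  move=> Fxy; have Fyx : F y x by rewrite Fsym.
  rewrite (DE _ _ Fxy) (DE _ _ Fyx) -(D0P _).1; congr D0; exact: val_inj.
have Doth x y : F x y -> D x (o x y) = ~~ D x y.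
  move=> Fxy; have [Fo _ _] := oP _ _ Fxy.
  rewrite (DE _ _ Fxy) (DE _ _ Fo) -(D0P _).2; congr D0; exact: val_inj.
have /fin_all_exists[s sP] : forall x, exists y, F x y && D x y.
  move=> x; have /eqP/cards2P[y [z [_ E]]] := F2 x.
  have Fxy : F x y by have := set21 y z; rewrite -E inE.
  have [Dxy|NDxy] := boolP (D x y); first by exists y; rewrite Fxy.
  by exists (o x y); rewrite Doth // NDxy; have [->] := oP _ _ Fxy.
have sF x : F x (s x) by case/andP: (sP x).
have sD x : D x (s x) by case/andP: (sP x).
have s_uniq x y : F x y -> D x y -> y = s x.
  move=> Fxy Dxy; have [_ _ /(_ _ (sF x))[->//|E]] := oP _ _ Fxy.
  by have := sD x; rewrite E Doth // Dxy.
exists s; split=> [x x' E|x|x y].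
(* Distinct [x] and [x'] would be the two neighbours of [s x], and neither dart from [s x] to them
   would lie in [D], against [Doth]. *)
- have Fyx : F (s x) x by rewrite Fsym.
  have Fyx' : F (s x) x' by rewrite Fsym E.
  have [_ _ /(_ _ Fyx')[->//|E']] := oP _ _ Fyx.
  have := Doth _ _ Fyx; rewrite -E' (Drev x') E //.
  by rewrite -{2}E (Drev x) // !sD.
- apply/eqP => E; have := Drev _ _ (sF x).
  by rewrite sD -[X in D _ X]E sD.
- apply/idP/orP=> [Fxy|[]/eqP->]; [|exact: sF|by rewrite Fsym].
  have [/s_uniq-> //|ND] := boolP (D x y); first by left.
  by right; apply/eqP/s_uniq; rewrite 1?Fsym // Drev.
Qed.

(** * Matchings as involutions *)

Lemma one_regular_involution (T : finType) (M : rel T) :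
    symmetric M -> (forall x, #|[set y | M x y]| = 1) ->
  exists2 m : T -> T, involutive m & forall x, M x (m x).
Proof.
move=> Msym M1.
have /fin_all_exists[m mP] : forall x, exists y, M x =1 pred1 y.
  move=> x; have /eqP/cards1P[y E] := M1 x.
  by exists y => z; have := in_set1 z y; rewrite -E inE.
exists m => x; last by rewrite mP /=.
by apply/esym/eqP; rewrite -[_ == _]mP Msym mP /=.
Qed.

Lemma set2_inj (T : finType) (x y z w : T) :
  [set x; y] = [set z; w] -> x = z /\ y = w \/ x = w /\ y = z.
Proof.
move=> E; have : x \in [set z; w] by rewrite -E set21.
have : y \in [set z; w] by rewrite -E set22.
have : z \in [set x; y] by rewrite E set21.
have : w \in [set x; y] by rewrite E set22.
by do 4!case/set2P=> ?; subst; auto.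
Qed.

Lemma perfect_matchingP (N : nat) (G : sgraph N) :
  perfect_matching G <->
  exists2 m : 'I_N -> 'I_N, involutive m & forall x, adj G x (m x).
Proof.
split=> [[P [/and3P[/eqP covP triP _] PE]]|[m mK mG]].
  have /fin_all_exists[m mP] : forall x, exists y, adj G x y /\ [set x; y] \in P.
    move=> x; have : x \in cover P by rewrite covP inE.
    case/bigcupP=> B PB xB; have [y [z [Gyz EB]]] := PE B PB; rewrite EB in PB xB.
    by case/set2P: xB => ->; [exists z | exists y; rewrite adj_sym setUC].
  exists m => x; last by have [] := mP x.
  have [Gx Px] := mP x; have [Gmx Pmx] := mP (m x).
  (* The blocks chosen for [x] and [m x] share the point [m x], hence coincide. *)
  have := def_pblock triP Px (set22 _ _).
  rewrite (def_pblock triP Pmx (set21 _ _)) => /set2_inj[[E _]|[] //].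
  by rewrite E adj_irr in Gx.
exists [set [set x; m x] | x in 'I_N]; split; last first.
  by move=> _ /imsetP[x _ ->]; exists x, (m x).
apply/and3P; split.
- rewrite cover_imset; apply/eqP/setP=> x; rewrite inE; apply/bigcupP.
  by exists x; rewrite // set21.
- apply/trivIsetP=> _ _ /imsetP[x _ ->] /imsetP[y _ ->]; apply: contraR.
  case/pred0Pn=> z /andP[/=].
  have E u : z \in [set u; m u] -> [set u; m u] = [set z; m z].
    by case/set2P=> -> //; rewrite mK setUC.
  by move=> /E-> /E->.
- by apply/imsetP=> -[x _ /setP/(_ x)]; rewrite set21 inE.
Qed.

(** * Matchings and 2-factors of cubic graphs *)

Lemma cubic_matching_orientation (N : nat) (G : sgraph N)
    (m : 'I_N -> 'I_N) :
    regular 3 G -> involutive m -> (forall x, adj G x (m x)) ->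
  exists s : 'I_N -> 'I_N,
    [/\ injective s, forall x, s (s x) != x
      & forall x y, adj G x y && (y != m x) = (y == s x) || (x == s y)].
Proof.
move=> G3 mK mG; apply: two_regular_orientation.
- by move=> x y /=; rewrite adj_sym eq_sym (can2_eq mK mK).
- by move=> x /=; rewrite adj_irr.
move=> x; have := cardsD1 (m x) [set y | adj G x y].
rewrite G3 inE mG => -[->]; apply: eq_card => y.
by rewrite !inE andbC.
Qed.

(** Separates the successor of a vertex from its predecessor, so that a cycle has degree exactly 2
    at each of its vertices. *)
Lemma next_next_neq (T : eqType) (c : seq T) (x : T) :
  uniq c -> 2 < size c -> x \in c -> next c (next c x) != x.
Proof.
move=> Uc szc /rot_to[i c' Ec].
rewrite -(next_rot i Uc) -(next_rot i Uc).
have : uniq (rot i c) by rewrite rot_uniq.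
have : 2 < size (rot i c) by rewrite size_rot.
rewrite Ec; case: c' {Ec} => [|y [|z c']] //= _; rewrite eqxx !inE !negb_or.
case/andP=> /and3P[/negPf xy xz _] _.
by rewrite (eq_sym y) xy eqxx eq_sym.
Qed.

Lemma perfect_matching_cover (N : nat) (G : sgraph N) :
  regular 3 G -> perfect_matching G -> disjoint_cycle_cover G.
Proof.
move=> G3 /perfect_matchingP[m mK mG].
have [s [s_inj ssN sG]] := cubic_matching_orientation G3 mK mG.
have Gs x : adj G x (s x).
  by have := sG x (s x); rewrite eqxx => /andP[].
have fsym := fconnect_sym s_inj.
(* The cycles are the orbits of [s]; [K x] depends only on the orbit of [x], whence uniqueness. *)
pose K x := ([set y | fconnect s x y], [set [set y; s y] | y in fconnect s x]).
exists [set K x | x in 'I_N]; split=> [_ /imsetP[x _ ->]|v].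
  have nextE y : y \in orbit s x -> next (orbit s x) y = s y.
    by move/(next_cycle (cycle_orbit s_inj x))/eqP.
  exists (orbit s x); split.
  - rewrite /ucycle orbit_uniq andbT; apply: sub_cycle (cycle_orbit s_inj x).
    by move=> y _ /eqP<-.
  (* The length is at least 3: [s] has no fixed point as [adj] is irreflexive, and no 2-cycle by
     [ssN]. *)
  - have U : uniq [:: x; s x; s (s x)].
      have sN y : s y != y.
        by apply/eqP=> E; have := Gs y; rewrite E adj_irr.
      by rewrite /= !inE negb_or !andbT (eq_sym x (s x)) sN (eq_sym x) ssN eq_sym sN.
    apply: (uniq_leq_size U) => y; rewrite !inE -fconnect_orbit.
    by case/or3P=> /eqP->; rewrite -?same_fconnect1_r ?connect0 ?fconnect1.
  - by apply/setP=> y; rewrite !inE fconnect_orbit.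
  - apply/setP=> B; apply/imsetP/imsetP=> -[y xy ->]; exists y => //.
    + by rewrite -fconnect_orbit.
    + by rewrite nextE // -fconnect_orbit.
    + by rewrite inE fconnect_orbit.
    + by rewrite nextE.
exists (K v); split=> [|_ [/imsetP[x _ ->]]].
  by split; [exact: imset_f | rewrite inE connect0].
rewrite inE => /(same_connect fsym) E.
congr pair; first by apply/setP=> y; rewrite !inE E.
by apply/setP=> B; apply/imsetP/imsetP=> -[y vy ->]; exists y;
  rewrite // inE ?E // -E.
Qed.

(** The cycles use exactly two of the three edges at each vertex; the remaining edges form the
    matching. *)
Lemma cover_perfect_matching (N : nat) (G : sgraph N) :
  regular 3 G -> disjoint_cycle_cover G -> perfect_matching G.
Proof.
move=> G3 [C [CG Cuniq]]; apply/perfect_matchingP.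
pose F x y := [exists H in C, [set x; y] \in H.2].
have Fsym : symmetric F by move=> x y; rewrite /F setUC.
have F2 x : [set y | F x y] \subset [set y | adj G x y] /\ #|[set y | F x y]| = 2.
  have [H [[HC Hx] Huniq]] := Cuniq x.
  have [c [/andP[cG Uc] szc H1 H2]] := CG H HC.
  have xc : x \in c by rewrite H1 inE in Hx.
  suff -> : [set y | F x y] = [set next c x; prev c x].
    split.
      apply/subsetP=> y; rewrite !inE => /orP[]/eqP->.
        exact: next_cycle cG xc.
      by rewrite adj_sym; apply: prev_cycle cG xc.
    rewrite cards2; case: eqVneq => // E.
    by have := next_next_neq Uc szc xc; rewrite E next_prev ?eqxx.
  apply/setP=> y; rewrite !inE; apply/exists_inP/orP.
    case=> H' H'C xyH'.
    (* An edge of [H'] at [x] puts [x] on [H'], and only one cycle of [C] passes through [x]. *)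
    have E : H = H'.
      apply: Huniq; split=> //.
      have [c' [_ _ -> H'2]] := CG H' H'C.
      move: xyH'; rewrite H'2 => /imsetP[z zc' /set2_inj[][-> _]]; rewrite inE //.
      by rewrite mem_next.
    move: xyH'; rewrite -E H2 => /imsetP[z zc /set2_inj[][-> ->]]; first by left.
    by right; rewrite prev_next.
  move=> xy; exists H => //; rewrite H2; apply/imsetP.
  case: xy => /eqP->; first by exists x.
  by exists (prev c x); rewrite ?mem_prev // next_prev // setUC.
have [|x|m mK mG] := @one_regular_involution _
    (fun x y => adj G x y && ~~ F x y); last by exists m => // x; have /andP[] := mG x.
- by move=> x y; rewrite adj_sym Fsym.
- have [FG cF] := F2 x; have := cardsD [set y | adj G x y] [set y | F x y].
  rewrite (setIidPr FG) cF G3 => E; apply: etrans E; apply: eq_card => y.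
  by rewrite !inE andbC.
Qed.

(** * Phases and perfect matchings *)

Local Open Scope ring_scope.

(* A set of unit numbers closed under conjugation that contains exactly one of
   z, z w, z w^2 for every unit z, where w is a primitive cube root of unity. *)
Definition sector (R : rcfType) (z : R[i]) : bool :=
  (2^-1 < complex.Re z) || (complex.Re z == -1).

Lemma sector_conj (R : rcfType) (z : R[i]) : sector z^*%C = sector z.
Proof. by case: z. Qed.

Lemma normc1 (R : rcfType) (z : R[i]) :
  `|z| = 1 -> complex.Re z ^+ 2 + complex.Im z ^+ 2 = 1.
Proof.
move=> z1; have := sqr_normc z; rewrite z1 expr1n; case: z {z1} => a b [].
by move=> E _ /=; rewrite E; ring.
Qed.

(** Eliminating the imaginary parts leaves a + b + c = 0 and ab + bc + ca = -3/4 for the real parts;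
    then [excl] puts at most one number in the sector and [some] at least one. *)
Lemma unit_triple_sector (R : rcfType) (x y z : R[i]) :
    `|x| = 1 -> `|y| = 1 -> `|z| = 1 -> x + y + z = 0 ->
  (sector x + sector y + sector z = 1)%N.
Proof.
move=> /normc1 + /normc1 + /normc1; case: x y z => [a p] [b q] [c r] /=.
move=> ap bq cr [] abc pqr; rewrite /sector /=.
(* The sum of the first two numbers has modulus 1, so their inner product is -1/2. *)
have dot : p * q = - a * b - 2^-1.
  have Ec : c = - a - b by lra.
  have Er : r = - p - q by lra.
  by rewrite Ec Er in cr; nra.
(* After squaring [dot], the imaginary parts enter only through p^2 = 1 - a^2 and q^2 = 1 - b^2. *)
have e2 : a * b + b * c + c * a = - (3 / 4).
  have : (p * q) ^+ 2 = (1 - a ^+ 2) * (1 - b ^+ 2).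
    have -> : 1 - a ^+ 2 = p ^+ 2 by lra.
    have -> : 1 - b ^+ 2 = q ^+ 2 by lra.
    by rewrite exprMn.
  have -> : c = - a - b by lra.
  by rewrite dot => E; lra.
have ge1 (u v : R) : u ^+ 2 + v ^+ 2 = 1 -> -1 <= u by move=> E; nra.
(* Both above 1/2 would put [w] below -1. If one is -1, the quadratic relation says (t - 1/2)^2 = 0
   for the other, and t = 1/2 meets neither alternative. *)
have excl (u v w : R) : u + v + w = 0 -> u * v + v * w + w * u = - (3 / 4) ->
    -1 <= w -> (2^-1 < u) || (u == -1) -> (2^-1 < v) || (v == -1) -> False.
  move=> uvw f2 w1; have Ew : w = - u - v by lra.
  rewrite Ew in f2; case/orP=> [ul|/eqP uE] /orP[vl|/eqP vE].
  - lra.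
  - by rewrite vE in f2; nra.
  - by rewrite uE in f2; nra.
  - by rewrite uE vE in f2; lra.
(* By [abc] and [e2], (1/2 - a)(1/2 - b)(1/2 - c) = - (1 + a)(1 + b)(1 + c). *)
have some : [|| (2^-1 < a) || (a == -1), (2^-1 < b) || (b == -1)
              | (2^-1 < c) || (c == -1)].
  rewrite !ltNge; apply/negPn; rewrite !negb_or !negbK.
  apply/negP=> /and3P[/andP[al an] /andP[bl bn] /andP[cl cn]].
  have lt1 (u : R) : u != -1 -> -1 <= u -> 0 < u + 1.
    by move=> un u1; rewrite -ltrBlDr sub0r lt_neqAle eq_sym un.
  have := mulr_gt0 (mulr_gt0 (lt1 a an (ge1 _ _ ap)) (lt1 b bn (ge1 _ _ bq)))
            (lt1 c cn (ge1 _ _ cr)).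
  have : 0 <= (2^-1 - a) * (2^-1 - b) * (2^-1 - c) by rewrite !mulr_ge0 ?subr_ge0.
  have Ec : c = - a - b by lra.
  rewrite Ec in e2 *; nra.
have Ha := ge1 _ _ ap; have Hb := ge1 _ _ bq; have Hc := ge1 _ _ cr.
have exab := excl a b c abc e2 Hc.
have exbc : _ -> _ -> False := excl b c a ltac:(lra) ltac:(lra) Ha.
have exca : _ -> _ -> False := excl c a b ltac:(lra) ltac:(lra) Hb.
move: exab exbc exca some.
case: (_ || (a == _)); case: (_ || (b == _)); case: (_ || (c == _)) => //=; tauto.
Qed.

Lemma swift_phases_matching (R : realType) (N : nat) (G : sgraph N) :
  regular 3 G -> swift_phases R G -> perfect_matching G.
Proof.
move=> G3 [A [[/is_hermitianmxP Aherm A1 A0] Asum]]; apply/perfect_matchingP.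
have Asym x y : A y x = (A x y)^*%C.
  by rewrite [in LHS]Aherm expr0 scale1r !mxE.
have Aadj x y : adj G x y -> `|A x y| = 1.
  by move=> xy; apply: A1; rewrite mxE xy.
have Anadj x y : ~~ adj G x y -> A x y = 0.
  by move=> /negPf xy; apply: A0; rewrite mxE xy.
have [|x|m mK mG] := @one_regular_involution _
    (fun x y => adj G x y && sector (A x y)).
- by move=> x y; rewrite adj_sym Asym sector_conj.
- have rowsum : \sum_(y in [set y | adj G x y]) A x y = 0.
    have /matrixP/(_ x ord0) := Asum; rewrite !mxE => E; apply: etrans E.
    rewrite [RHS](bigID (mem [set y | adj G x y])) /= [X in _ + X]big1 ?addr0.
      by apply: eq_bigr => y _; rewrite mxE mulr1.
    by move=> y; rewrite inE => /Anadj->; rewrite mul0r.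
  have -> : #|[set y | adj G x y && sector (A x y)]|
      = (\sum_(y in [set y | adj G x y]) sector (A x y))%N.
    rewrite -sum1dep_card big_mkcondr /=; apply: eq_big => [y|y _].
      by rewrite inE.
    by case: (sector _).
  (* Listing the three neighbours turns row sum and count into the data of [unit_triple_sector]. *)
  move: rowsum; rewrite -!big_enum /=.
  have : all (adj G x) (enum [set y | adj G x y]).
    by apply/allP=> y; rewrite mem_enum inE.
  have := G3 x; rewrite cardE.
  case: (enum _) => [|a [|b [|c []]]] //= _ /and4P[xa xb xc _].
  rewrite !big_cons !big_nil !addr0 addn0 addrA addnA.
  by apply: unit_triple_sector; apply: Aadj.
- by exists m => // x; have /andP[] := mG x.
Qed.

Lemma unit_triple_sum (R : rcfType) :
  exists2 w : R[i], `|w| = 1 & 1 + w + w^*%C = 0.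
Proof.
have s3 : Num.sqrt 3 ^+ 2 = 3 :> R by rewrite sqr_sqrtr.
(* A primitive cube root of unity; its conjugate is its square. *)
exists ((- 2^-1) +i* (Num.sqrt 3 / 2))%C; apply/eqP.
  rewrite -(@eqrXn2 _ 2) // expr1n sqr_normc eq_complex /=.
  by apply/andP; split; apply/eqP; lra.
by rewrite eq_complex /=; apply/andP; split; apply/eqP; lra.
Qed.

Lemma matching_swift_phases (R : realType) (N : nat) (G : sgraph N) :
  regular 3 G -> perfect_matching G -> swift_phases R G.
Proof.
move=> G3 /perfect_matchingP[m mK mG].
have [s [s_inj ssN sG]] := cubic_matching_orientation G3 mK mG.
have [w w1 w_sum] := unit_triple_sum R.
pose A : 'M[R[i]]_N := \matrix_(x, y)
  ((y == m x)%:R + (y == s x)%:R * w + (x == s y)%:R * w^*%C).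
(* No edge is oriented both ways, so an entry of [A] never adds [w] to its conjugate. *)
have sN2 x y : y = s x -> x != s y by move=> ->; rewrite eq_sym.
exists A; split; first split.
- apply/is_hermitianmxP/matrixP=> x y; rewrite expr0 scale1r !mxE.
  rewrite [RHS](_ : _ = ((x == m y)%:R + (x == s y)%:R * w
    + (y == s x)%:R * w^*%C)^*%C) // !rmorphD !rmorphM /= !conjc_nat conjcK.
  by rewrite addrAC (eq_sym y (m x)) (can2_eq mK mK).
- move=> x y; rewrite !mxE; have := sG x y.
  case: (adj G x y) => /=; last by move=> _ /esym/eqP; rewrite oner_eq0.
  case: (eqVneq y (m x)) => [-> /esym/norP[/negPf-> /negPf->] _|_ /=].
    by rewrite !mul0r !addr0 normr1.
  case: (eqVneq y (s x)) => [yE _ _|_ /= <- _].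
    by rewrite (negPf (sN2 _ _ yE)) mul0r mul1r add0r addr0.
  by rewrite mul0r mul1r !add0r normcJ.
- move=> x y; rewrite !mxE; have := sG x y.
  case: (boolP (adj G x y)) => /= [_ _ /eqP|]; first by rewrite oner_eq0.
  case: (eqVneq y (m x)) => [-> |]; first by rewrite mG.
  by move=> _ _ /esym/norP[/negPf-> /negPf->] _; rewrite !mul0r !addr0.
- apply/matrixP=> x z; rewrite !mxE.
  (* Writing [x == s y] as [y == finv s x] leaves one nonzero term in each of the three sums. *)
  rewrite (eq_bigr (fun y => (y == m x)%:R + (y == s x)%:R * w
     + (y == finv s x)%:R * w^*%C)); last first.
    move=> y _; rewrite !mxE mulr1; congr (_ + _%:R * _).
    by rewrite -(inj_eq s_inj y) f_finv // eq_sym.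
  rewrite !big_split /= -!mulr_suml.
  have one u : \sum_(y < N) (y == u)%:R = 1 :> R[i].
    by rewrite (bigD1 u) //= eqxx big1 ?addr0 // => y /negPf->.
  by rewrite !one !mul1r w_sum.
Qed.

Theorem theorem3 (R : realType) (N : nat) (G : sgraph N) (G3 : regular 3 G) :
  [/\ perfect_matching G <-> disjoint_cycle_cover G,
      swift_phases R G <-> perfect_matching G
    & swift_phases R G <-> disjoint_cycle_cover G].
Proof.
have mc : perfect_matching G <-> disjoint_cycle_cover G.
  by split; [exact: perfect_matching_cover | exact: cover_perfect_matching].
have sm : swift_phases R G <-> perfect_matching G.
  by split; [exact: swift_phases_matching | exact: matching_swift_phases].
by split=> //; apply: iff_trans mc.
Qed.
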